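(* Let $0<k_1<k_2$ be fixed, $k_{3,1}=k_{3,1}(n)\ge0$, $k_{3,2}=k_{3,2}(n)\ge0$, and consider the eigenfrequencies in the acoustic band, $\omega^2\in(0,2k_1)$, of the diatomic chain of length $2n$ (see context), as $n\to\infty$. Let the index $k=k(n)\ge1$ satisfy $k\ll n$. (A) Suppose $k_{3,1}\not\approx0$ and $k_{3,2}\gg\frac1n$. - (Lower band edge, $\omega^2\approx0$.) $\theta^{(2n-k+1)}\approx\frac{k}{n-1}\pi$. - (Upper band edge, $\omega^2\approx2k_1$.) $\pi-\theta^{(2n-n_2+k)}\approx\frac{k}{n-1}\pi$. (B) Suppose $k_{3,1}\not\approx0$ and $k_{3,2}\ll\frac1n$. - (Lower band edge, $\omega^2\approx0$.) $\theta^{(2n-k+1)}\approx\frac{k-\frac12}{n-1}\pi$. - (Upper band edge, $\omega^2\approx2k_1$.) $\pi-\theta^{(2n-n_2+k)}\approx\frac{k-\frac12}{n-1}\pi$.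
   Context: **Chain.** $\mathcal L$ is the $2n\times2n$ real symmetric tridiagonal matrix with diagonal $(-k_1-k_{3,1},\,-k_1-k_2,\dots,-k_1-k_2,\,-k_1-k_{3,2})$ and off-diagonal entries $\mathcal L_{2m-1,2m}=k_1$ ($1\le m\le n$), $\mathcal L_{2m,2m+1}=k_2$ ($1\le m\le n-1$). $\omega\ge0$ is an eigenfrequency if $-\omega^2$ is an eigenvalue of $\mathcal L$ (eigenvalues are simple). **Ordering.** Let $n_2$ be the number of eigenfrequencies with $\omega^2\in(0,2k_1)$ (acoustic band), labelled so that $0<(\omega^{(2n)})^2<(\omega^{(2n-1)})^2<\dots<(\omega^{(2n-n_2+1)})^2<2k_1$. For these define $\theta^{(j)}\in(0,\pi)$ by $(\omega^{(j)})^2=k_1+k_2-\sqrt{k_1^2+k_2^2+2k_1k_2\cos\theta^{(j)}}$, so that $\pi>\theta^{(2n-n_2+1)}>\dots>\theta^{(2n)}>0$. **Asymptotic notation** (as $n\to\infty$). $f\approx g$ (with $g$ not identically zero) means $(f-g)/f\to0$. $f\not\approx0$ means $\liminf_n|f|>0$. $|f|\ll|g|$ (equivalently $|g|\gg|f|$) means $f/g\to0$. *)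

(* Defs.v *)
From HB Require Import structures.
From mathcomp Require Import all_boot all_order all_algebra finmap.
From mathcomp Require Import all_classical all_reals all_analysis.

Set Implicit Arguments.
Unset Strict Implicit.
Unset Printing Implicit Defensive.

Import Order.TTheory GRing.Theory Num.Theory.
Import numFieldNormedType.Exports.

Local Open Scope classical_set_scope.
Local Open Scope ring_scope.

Section Chain.
Context {R : realType}.
Variables (k1 k2 k31 k32 : R) (n : nat).

(* Indices are 0-based: entry (i, j) here is entry (i + 1, j + 1) on paper, so
   the link between i and i + 1 has stiffness k1 for even i and k2 for odd i. *)
Definition link (i : nat) : R := if odd i then k2 else k1.

Definition chain_mx : 'M[R]_(2 * n) :=
  \matrix_(i, j)
    if i == j :> nat then
      if i == 0%N :> nat then - k1 - k31
      else if i == (2 * n).-1 :> nat then - k1 - k32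
      else - k1 - k2
    else if i.+1 == j :> nat then link i
    else if j.+1 == i :> nat then link j
    else 0.

Definition eigenfrequencies : set R :=
  [set w | 0 <= w /\ eigenvalue chain_mx (- w ^+ 2)].

Definition acoustic : set R :=
  [set w | eigenfrequencies w /\ 0 < w ^+ 2 < 2 * k1].

(* The set is finite, so fset_set does not fall back to its junk value. *)
Definition n2 : nat := #|` fset_set acoustic|.

(* omega j is the frequency labelled (j) for 2n - n2 < j <= 2n: labels decrease
   from 2n as frequencies increase.  It is 0 for all other labels. *)
Definition omega (j : nat) : R :=
  if (j <= 2 * n)%N then
    nth 0 (sort <=%R (enum_fset (fset_set acoustic))) (2 * n - j)
  else 0.

(* The point of ]0, pi[ satisfying the dispersion relation (unique when it
   exists); 0 when omega j is not an acoustic frequency. *)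
Definition theta (j : nat) : R :=
  xget 0 [set t : R | 0 < t < pi /\
    omega j ^+ 2
      = k1 + k2 - Num.sqrt (k1 ^+ 2 + k2 ^+ 2 + 2 * k1 * k2 * cos t)].

End Chain.

Section Asymptotics.
Context {R : realType}.
Implicit Types f g : nat -> R.

(* As x / 0 = 0, the denominators are explicitly required to be nonzero for all
   large n; otherwise g = 0 would satisfy much_less f g. *)
Definition asymp_equal f g : Prop :=
  [/\ exists n, g n != 0,
      \forall n \near \oo, f n != 0 &
      (fun n => (f n - g n) / f n) @ \oo --> (0 : R)].

Definition much_less f g : Prop :=
  (\forall n \near \oo, g n != 0) /\
  (fun n => f n / g n) @ \oo --> (0 : R).

(* The lower limit is taken in the extended reals, as f may be unbounded. *)
Definition not_approx0 f : Prop :=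
  (0 < limn_einf (fun n => (`|f n|)%:E))%E.

End Asymptotics.

(* Main.v *)
(* For omega^2 = k1 + k2 - s with s = |k2 + k1 exp (i t)| and 0 < t < pi, solving
   the recurrence from the left end shows that omega is an eigenfrequency iff
   [secular] vanishes at t. With psi = arg (k2 + k1 exp (i t)) and
   T = tan (psi / 2), the secular function is, up to a positive factor, the
   imaginary part of
     exp (i n t) (k31 + i (2 k2 - k31) T) (k32 + i (2 k2 - k32) T),
   so its zeros are the points where the phase n t + gamma1 + gamma2 is a
   multiple of pi, gamma_j being the argument of the j-th end factor.
   As T is Lipschitz and comparable to min (t, pi - t), the shift gamma1 is
   O(min (t, pi - t)). If k32 >> 1/n, then gamma2 = o(n min (t, pi - t)), and if
   k32 << 1/n, then gamma2 - pi/2 = o(n min (t, pi - t)) at distance at least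
   1/(4n) from 0 and pi, with no zero closer than that. The o(n)-Lipschitz
   remainder leaves the phase increasing, so that the j-th zero is the point
   where the phase is j pi; counting from either end gives both band edges. *)

Require Import Defs.
From HB Require Import structures.
From mathcomp Require Import all_boot all_order all_algebra finmap.
From mathcomp Require Import all_classical all_reals all_analysis.
From mathcomp Require Import ring lra.

Set Implicit Arguments.
Unset Strict Implicit.
Unset Printing Implicit Defensive.

Import Order.TTheory GRing.Theory Num.Theory.
Import numFieldNormedType.Exports.

Local Open Scope classical_set_scope.
Local Open Scope ring_scope.

(** * Elementary inequalities *)

Lemma derive_le_lipschitz (R : realType) (f df : R -> R) (L : R) :
  (forall x : R, is_derive x 1 f (df x)) -> (forall x, `|df x| <= L) ->
  forall x y, `|f x - f y| <= L * `|x - y|.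
Proof.
move=> fdf dfL x y; wlog xy : x y / y <= x => [hw|].
  by have [/hw //|/ltW /hw] := leP y x; rewrite distrC (distrC y).
have cf : {within `[y, x], continuous f}.
  apply: continuous_subspaceT => z; apply: differentiable_continuous.
  by apply/derivable1_diffP; case: (fdf z).
have [c _ ->] := MVT_segment xy (fun z _ => fdf z) cf.
by rewrite normrM ler_wpM2r.
Qed.

Lemma sin_lipschitz (R : realType) (x y : R) : `|sin x - sin y| <= `|x - y|.
Proof.
rewrite -[leRHS]mul1r; apply: derive_le_lipschitz => z; exact: cos_max.
Qed.

Lemma cos_lipschitz (R : realType) (x y : R) : `|cos x - cos y| <= `|x - y|.
Proof.
rewrite -[leRHS]mul1r.
by apply: derive_le_lipschitz => z; rewrite normrN; exact: sin_max.
Qed.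

Lemma atan_lipschitz (R : realType) (x y : R) : `|atan x - atan y| <= `|x - y|.
Proof.
rewrite -[leRHS]mul1r.
apply: (derive_le_lipschitz (df := fun z => (1 + z ^+ 2)^-1)) => z.
have z1 : 1 <= 1 + z ^+ 2 by rewrite lerDl sqr_ge0.
by rewrite ger0_norm ?invr_ge0 ?(le_trans _ z1)// invf_le1// (lt_le_trans _ z1).
Qed.

Lemma norm_atan_le (R : realType) (x : R) : `|atan x| <= `|x|.
Proof. by have := atan_lipschitz x 0; rewrite atan0 !subr0. Qed.

Lemma norm_sin_le (R : realType) (x : R) : `|sin x| <= `|x|.
Proof. by have := sin_lipschitz x 0; rewrite sin0 !subr0. Qed.

(* [sin x = 2 tan (x/2) cos^2 (x/2)], where [cos^2 (x/2) >= 1/2] and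
   [tan (x/2) >= x/2] because [atan] is 1-Lipschitz. *)
Lemma half_le_sin (R : realType) (x : R) : 0 <= x <= pi / 2 -> x / 2 <= sin x.
Proof.
move=> /andP[x0 xpi].
have pi0 := pi_gt0 R.
have c0 : 0 < cos (x / 2) by apply: cos_gt0_pihalf; lra.
have cx : 0 <= cos x by apply: cos_ge0_pihalf; lra.
have xE : x = (x / 2) *+ 2 by rewrite -mulr_natr; field.
have tx : x / 2 <= tan (x / 2).
  rewrite -{1}[x / 2]tanK ?in_itv/=; last lra.
  have t0 : 0 <= tan (x / 2).
    by rewrite mulr_ge0 ?invr_ge0 ?(ltW c0)// sin_ge0_pi//; lra.
  apply: le_trans (ler_norm _) _; apply: le_trans (norm_atan_le _) _.
  by rewrite ger0_norm.
apply: le_trans tx _.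
have c2 : 1 <= cos (x / 2) ^+ 2 *+ 2.
  by move: cx; rewrite [X in cos X]xE cos_mulr2n subr_ge0.
rewrite [X in _ <= sin X]xE sin_mulr2n /tan ler_pdivrMr//.
have s0 : 0 <= sin (x / 2) by apply: sin_ge0_pi; lra.
have -> : (cos (x / 2) * sin (x / 2)) *+ 2 * cos (x / 2) =
    sin (x / 2) * (cos (x / 2) ^+ 2 *+ 2) by ring.
by rewrite ler_peMr.
Qed.

Lemma sin_pi_sub (R : realType) (x : R) : sin (pi - x) = sin x.
Proof. by rewrite sinB sinpi cospi; ring. Qed.

Lemma sin_ge_min (R : realType) (x : R) :
  0 <= x <= pi -> Num.min x (pi - x) / 2 <= sin x.
Proof.
move=> /andP[x0 xpi]; have [xp|xp] := leP x (pi / 2).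
  apply: le_trans (half_le_sin _); last by rewrite x0.
  by rewrite ler_pM2r ?invr_gt0// ge_min lexx.
rewrite -sin_pi_sub; apply: le_trans (half_le_sin _); last by lra.
by rewrite ler_pM2r ?invr_gt0// ge_min lexx orbT.
Qed.

Lemma sin_le_min (R : realType) (x : R) :
  0 <= x <= pi -> sin x <= Num.min x (pi - x).
Proof.
move=> /andP[x0 xpi]; rewrite le_min; apply/andP; split.
  by apply: le_trans (ler_norm _) _; rewrite (le_trans (norm_sin_le _))// ger0_norm.
rewrite -sin_pi_sub; apply: le_trans (ler_norm _) _.
by rewrite (le_trans (norm_sin_le _))// ger0_norm// subr_ge0.
Qed.

Lemma cos_atan_gt0 (R : realType) (x : R) : 0 < cos (atan x).
Proof. by apply: cos_gt0_pihalf; rewrite atan_gtNpi2 atan_ltpi2. Qed.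

Lemma sin_atan (R : realType) (x : R) : sin (atan x) = x * cos (atan x).
Proof.
by rewrite -{2}[x]atanK /tan mulfVK// gt_eqF// cos_atan_gt0.
Qed.

Lemma lipschitz_continuous_cc (R : realType) (f : R -> R) (a b L : R) :
  (forall x y, a <= x <= b -> a <= y <= b -> `|f x - f y| <= L * `|x - y|) ->
  {within `[a, b], continuous f}.
Proof.
move=> fL; apply/subspace_continuousP => x; rewrite /= in_itv/= => xab.
apply/cvgrPdist_le => e e0.
near=> y.
have yab : y \in `[a, b] by near: y; apply: withinT; exact: nbhs_filter.
rewrite in_itv/= in yab.
apply: le_trans (fL _ _ xab yab) _.
have L1 : 0 < `|L| + 1 by rewrite ltr_wpDl.
have : `|x - y| <= e / (`|L| + 1).
  near: y; apply: cvg_within.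
  have /cvgrPdist_le := @cvg_id _ (nbhs x); apply.
  by rewrite divr_gt0.
rewrite ler_pdivlMr// => h; apply: le_trans _ h; rewrite mulrC ler_wpM2l//.
by rewrite (le_trans (ler_norm _))// lerDl.
Unshelve. all: by end_near. Qed.

(** * The dispersion relation *)

(** The modulus of [k2 + k1 exp (i t)]; the acoustic branch reads
    [omega^2 = k1 + k2 - band k1 k2 t]. *)
Definition band (R : realType) (k1 k2 t : R) : R :=
  Num.sqrt (k1 ^+ 2 + k2 ^+ 2 + 2 * k1 * k2 * cos t).

(* [tan (psi / 2)], where [psi] is the argument of [k2 + k1 exp (i t)]. *)
Definition tan_half_arg (R : realType) (k1 k2 t : R) : R :=
  k1 * sin t / (band k1 k2 t + k2 + k1 * cos t).

Section Band.
Context {R : realType} (k1 k2 : R).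
Hypotheses (k1_gt0 : 0 < k1) (k12 : k1 < k2).

Let k2_gt0 : 0 < k2. Proof. exact: lt_trans k12. Qed.

Let k1k2_gt0 : 0 < k1 * k2. Proof. exact: mulr_gt0. Qed.

Let cosp (t : R) : 0 <= k1 * k2 * (1 + cos t).
Proof. by rewrite mulr_ge0 ?(ltW k1k2_gt0)//; have := cos_geN1 t; lra. Qed.

Let cosm (t : R) : 0 <= k1 * k2 * (1 - cos t).
Proof. by rewrite mulr_ge0 ?(ltW k1k2_gt0)// subr_ge0 cos_le1. Qed.

Lemma band_sqr (t : R) : band k1 k2 t ^+ 2 = k1 ^+ 2 + k2 ^+ 2 + 2 * k1 * k2 * cos t.
Proof.
rewrite sqr_sqrtr//; by have := cosp t; have := sqr_ge0 (k2 - k1); lra.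
Qed.

Lemma band_ge (t : R) : k2 - k1 <= band k1 k2 t.
Proof.
rewrite -ler_sqr ?nnegrE ?sqrtr_ge0 ?subr_ge0 ?(ltW k12)// band_sqr.
by have := cosp t; lra.
Qed.

Lemma band_gt0 (t : R) : 0 < band k1 k2 t.
Proof. by apply: lt_le_trans (band_ge t); rewrite subr_gt0. Qed.

Lemma band_le (t : R) : band k1 k2 t <= k1 + k2.
Proof.
rewrite -ler_sqr ?nnegrE ?sqrtr_ge0 ?addr_ge0 ?(ltW k1_gt0) ?(ltW k2_gt0)// band_sqr.
by have := cosm t; lra.
Qed.

Lemma lt_band (t u : R) : 0 <= t -> t < u -> u <= pi -> band k1 k2 u < band k1 k2 t.
Proof.
move=> t0 tu upi; rewrite -ltr_sqr ?nnegrE ?sqrtr_ge0// !band_sqr.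
have : cos u < cos t.
  rewrite ltr_cos// in_itv/=; apply/andP; split; lra.
by rewrite -[_ < cos t](ltr_pM2l k1k2_gt0); lra.
Qed.

Lemma band_lt (t : R) : 0 < t <= pi -> band k1 k2 t < k1 + k2.
Proof.
by case/andP=> t0 tpi; apply: lt_le_trans (band_le 0); exact: lt_band.
Qed.

Lemma band_gt (t : R) : 0 <= t < pi -> k2 - k1 < band k1 k2 t.
Proof.
by case/andP=> t0 tpi; apply: le_lt_trans (band_ge pi) _; exact: lt_band.
Qed.

(** The difference of squares is [2 k1 k2 (cos t - cos u)], and the sum of the two moduli is at
    least [2 (k2 - k1)], which is positive because [k1 < k2]. *)
Lemma band_lipschitz (t u : R) :
  `|band k1 k2 t - band k1 k2 u| <= k1 * k2 / (k2 - k1) * `|t - u|.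
Proof.
have g0 : 0 < k2 - k1 by rewrite subr_gt0.
rewrite mulrAC ler_pdivlMr//.
have b2 : 2 * (k2 - k1) <= band k1 k2 t + band k1 k2 u.
  by have := band_ge t; have := band_ge u; lra.
rewrite -(ler_pM2l (ltr0Sn R 1)) mulrCA.
apply: (@le_trans _ _ (`|band k1 k2 t - band k1 k2 u| *
    (band k1 k2 t + band k1 k2 u))); first by rewrite ler_wpM2l.
rewrite -[band k1 k2 t + band k1 k2 u]gtr0_norm; last by rewrite addr_gt0 ?band_gt0.
rewrite -normrM -subr_sqr !band_sqr.
have -> : k1 ^+ 2 + k2 ^+ 2 + 2 * k1 * k2 * cos t -
    (k1 ^+ 2 + k2 ^+ 2 + 2 * k1 * k2 * cos u) = 2 * (k1 * k2) * (cos t - cos u).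
  by ring.
have k20 : 0 <= 2 * (k1 * k2) by rewrite mulr_ge0 ?(ltW k1k2_gt0).
by rewrite normrM ger0_norm// [leRHS]mulrA ler_wpM2l// cos_lipschitz.
Qed.

Let D t := band k1 k2 t + k2 + k1 * cos t.

Lemma tan_half_arg_denom (t : R) : 2 * (k2 - k1) <= D t.
Proof. rewrite /D; have := band_ge t.
have : 0 <= k1 * (1 + cos t) by rewrite mulr_ge0 ?(ltW k1_gt0)//; have := cos_geN1 t; lra.
lra. Qed.

Lemma tan_half_arg_gt0 (t : R) : 0 < t < pi -> 0 < tan_half_arg k1 k2 t.
Proof.
move=> /sin_gt0_pi st; rewrite /tan_half_arg divr_gt0 ?mulr_gt0//.
by have := tan_half_arg_denom t; rewrite /D; move: k12; lra.
Qed.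

(** The numerator [k1 sin t] is comparable to [min (t, pi - t)], and the denominator [D t] stays
    between [2 (k2 - k1)] and [2 (k1 + k2)]. *)
Lemma tan_half_arg_bounds : exists2 C : R, 1 <= C & [/\
  forall t : R, 0 <= t <= pi -> tan_half_arg k1 k2 t <= C * Num.min t (pi - t),
  forall t : R, 0 <= t <= pi -> Num.min t (pi - t) <= C * tan_half_arg k1 k2 t &
  forall t u, `|tan_half_arg k1 k2 t - tan_half_arg k1 k2 u| <= C * `|t - u|].
Proof.
have [k1p k2p] : 0 < k1 /\ k1 < k2 by [].
have g0 : 0 < k2 - k1 by rewrite subr_gt0.
have g1 : 0 < (k2 - k1)^-1 by rewrite invr_gt0.
have k20 : 0 < k2 by lra.
have Dg := tan_half_arg_denom.
have D0 t : 0 < D t by have := Dg t; lra.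
have Dinv t : (D t)^-1 <= (k2 - k1)^-1.
  by rewrite lef_pV2 ?posrE//; have := Dg t; lra.
have kD_ge0 t : 0 <= k1 / D t by rewrite divr_ge0// ltW.
have kD_le t : k1 / D t <= k1 / (k2 - k1) by rewrite ler_pM2l.
have DL t u : `|D t - D u| <= (k1 * k2 / (k2 - k1) + k1) * `|t - u|.
  have -> : D t - D u = (band k1 k2 t - band k1 k2 u) + k1 * (cos t - cos u).
    by rewrite /D; ring.
  rewrite (le_trans (ler_normD _ _))// mulrDl lerD ?band_lipschitz//.
  by rewrite normrM gtr0_norm// ler_pM2l ?cos_lipschitz.
have TE t : tan_half_arg k1 k2 t = k1 * sin t / D t by [].
(* [C1] serves the upper bound, [C2] the lower bound and [C3] the Lipschitz bound; since all are
   positive, [1 + C1 + C2 + C3] serves all three. *)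
set C1 := k1 / (k2 - k1).
set C2 := 4 * (k1 + k2) / k1.
set C3 := C1 + C1 / (k2 - k1) * (k1 * k2 / (k2 - k1) + k1).
have C10 : 0 < C1 by rewrite divr_gt0.
have C20 : 0 < C2 by rewrite divr_gt0//; lra.
have C40 : 0 < k1 * k2 / (k2 - k1) + k1.
  by rewrite addr_gt0// divr_gt0// mulr_gt0.
have C30 : 0 < C3 by rewrite addr_gt0// mulr_gt0// divr_gt0.
exists (1 + C1 + C2 + C3); first by lra.
have minge0 (t : R) : 0 <= t <= pi -> 0 <= Num.min t (pi - t).
  by move=> /andP[? ?]; rewrite le_min subr_ge0; apply/andP.
split=> [t tpi|t tpi|t u].
- apply: (@le_trans _ _ (C1 * Num.min t (pi - t))); last first.
    by rewrite ler_wpM2r ?minge0//; lra.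
  by rewrite TE mulrAC ler_pM ?sin_le_min ?sin_ge0_pi ?kD_ge0.
- have T0 : 0 <= tan_half_arg k1 k2 t.
    by rewrite TE divr_ge0 ?mulr_ge0 ?sin_ge0_pi// ltW.
  apply: (@le_trans _ _ (C2 * tan_half_arg k1 k2 t)); last by rewrite ler_wpM2r//; lra.
  have := sin_ge_min tpi; rewrite ler_pdivrMr// => /le_trans; apply.
  have -> : C2 * tan_half_arg k1 k2 t = sin t * (4 * (k1 + k2) / D t).
    by rewrite /C2 TE; field; rewrite !gt_eqF.
  rewrite ler_wpM2l ?sin_ge0_pi// ler_pdivlMr//.
  rewrite /D; have := band_le t.
  have : 0 <= k1 * (1 - cos t) by rewrite mulr_ge0 ?(ltW k1_gt0)// subr_ge0 cos_le1.
  lra.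
- apply: (@le_trans _ _ (C3 * `|t - u|)); last by rewrite ler_wpM2r//; lra.
  have -> : tan_half_arg k1 k2 t - tan_half_arg k1 k2 u =
      k1 * (sin t - sin u) / D t + (k1 * sin u) / D u / D t * (D u - D t).
    by rewrite !TE; field; rewrite !gt_eqF.
  rewrite (le_trans (ler_normD _ _))// /C3 mulrDl lerD//.
    rewrite !normrM (gtr0_norm k1_gt0) normfV (gtr0_norm (D0 t)) mulrAC.
    by rewrite ler_pM ?sin_lipschitz ?kD_ge0.
  rewrite normrM -[leRHS]mulrA ler_pM//; last by rewrite (distrC t) DL.
  rewrite !normrM !normfV !(gtr0_norm (D0 _)) (gtr0_norm k1_gt0) (mulrAC k1).
  rewrite ler_pM ?invr_ge0 ?(ltW (D0 _)) ?Dinv ?mulr_ge0 ?invr_ge0 ?(ltW (D0 _)) ?(ltW k1_gt0)//.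
  by rewrite -[leRHS]mulr1 ler_pM ?kD_ge0 ?sin_max.
Qed.

End Band.

(** * The secular equation *)

(** The imaginary part written out in real terms. Being polynomial in [x1] and [x2], it also covers
    a free end, where [(2 k2 - x) / x] would have a zero denominator. *)
Definition secular (R : realType) (k1 k2 x1 x2 : R) (n : nat) (t : R) : R :=
  let T := tan_half_arg k1 k2 t in
  sin (n%:R * t) * (x1 * x2 - (2 * k2 - x1) * (2 * k2 - x2) * T ^+ 2)
  + cos (n%:R * t) * (x1 * (2 * k2 - x2) + x2 * (2 * k2 - x1)) * T.

(* The solution of the eigenvalue equation that satisfies the left boundary
   condition. *)
Definition mode (R : realType) (k1 k2 x1 t : R) (i : nat) : R :=
  let s := band k1 k2 t in
  let S m := sin (m%:R * t) in
  let m := i./2 in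
  if odd i then k2 * s * S m.+1 - (k2 - x1) * (k1 * S m + k2 * S m.+1)
  else k2 * (k2 * S m + k1 * S m.+1) - (k2 - x1) * s * S m.

Section Spectrum.
Context {R : realType} (k1 k2 : R).
Hypotheses (k1_gt0 : 0 < k1) (k12 : k1 < k2).

Let k2_gt0 : 0 < k2. Proof. exact: lt_trans k12. Qed.

(** A column of the matrix has at most three nonzero entries. Writing the entries of [v] through [f]
    on all naturals lets neighbouring entries be named without bounds on their indices. *)
Lemma chain_mx_mul (x1 x2 : R) (n : nat) (v : 'rV[R]_(2 * n)) (f : nat -> R)
    (i : 'I_(2 * n)) :
  (forall j : 'I_(2 * n), v 0 j = f j) ->
  (v *m chain_mx k1 k2 x1 x2 n) 0 i =
    f i * (if i == 0%N :> nat then - k1 - x1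
           else if i == (2 * n).-1 :> nat then - k1 - x2 else - k1 - k2)
    + (if (0 < i)%N then link k1 k2 i.-1 * f i.-1 else 0)
    + (if (i.+1 < 2 * n)%N then link k1 k2 i * f i.+1 else 0).
Proof.
move=> vf; rewrite mxE.
pose d := if i == 0%N :> nat then - k1 - x1
          else if i == (2 * n).-1 :> nat then - k1 - x2 else - k1 - k2.
rewrite (eq_bigr (fun j : 'I_(2 * n) => (if j == i :> nat then f j * d else 0) +
    (if j.+1 == i :> nat then link k1 k2 j * f j else 0) +
    (if j == i.+1 :> nat then link k1 k2 i * f j else 0))); last first.
  move=> j _; rewrite mxE vf /d.
  case: (eqVneq (j : nat) i) => [->|ji].
    by rewrite (gtn_eqF (ltnSn i)) (ltn_eqF (ltnSn i)) !addr0.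
  rewrite (eq_sym i.+1); case: eqVneq => [<-|_].
    by rewrite (ltn_eqF (ltnW (ltnSn j.+1))) addr0 add0r mulrC.
  by case: eqP => _; rewrite ?add0r ?addr0 ?mulr0// mulrC.
rewrite !big_split/=; congr (_ + _ + _); rewrite -big_mkcond/=.
- by rewrite (big_ord1_eq _ (fun j => f j * d)) ltn_ord.
- case: (posnP i) => [->|i0]; first by rewrite big_pred0.
  rewrite (eq_bigl (fun j : 'I_(2 * n) => j == i.-1 :> nat)).
    by rewrite (big_ord1_eq _ (fun j => link k1 k2 j * f j)) prednK// ltnW// ltnS ltnW.
  by move=> j; rewrite -{1}(prednK i0) eqSS.
- by rewrite (big_ord1_eq _ (fun j => link k1 k2 i * f j)).
Qed.

(** The interior rows of the eigenvalue equation at [band k1 k2 t - k1 - k2], with the diagonal term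
    cancelled. The addition formulas reduce both parities to the identities for [band^2] and
    [sin^2]. The recurrence continues past the end of the chain. *)
Lemma mode_rec (x1 t : R) (i : nat) :
  link k1 k2 i * mode k1 k2 x1 t i + link k1 k2 i.+1 * mode k1 k2 x1 t i.+2
    = band k1 k2 t * mode k1 k2 x1 t i.+1.
Proof.
have bE := band_sqr k1_gt0 k12 t.
have s2c2 : sin t ^+ 2 = 1 - cos t ^+ 2 by exact: sin2cos2.
have SE (m : nat) : sin (m.+1%:R * t) = sin (m%:R * t) * cos t + cos (m%:R * t) * sin t.
  by rewrite -natr1 mulrDl mul1r sinD.
have CE (m : nat) : cos (m.+1%:R * t) = cos (m%:R * t) * cos t - sin (m%:R * t) * sin t.
  by rewrite -natr1 mulrDl mul1r cosD.
rewrite /mode /link /= negbK uphalf_half; case: ifP => oi /=.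
- rewrite add1n !(SE, CE).
  set s := band _ _ _ in bE *; set S := sin (_ * t); set C := cos (_ * t).
  set c := cos t in bE s2c2 *; set r := sin t in s2c2 *.
  move: s S C c r bE s2c2 => s S C c r bE s2c2.
  ring: bE s2c2.
- rewrite add0n !(SE, CE).
  set s := band _ _ _ in bE *; set S := sin (_ * t); set C := cos (_ * t).
  set c := cos t in bE s2c2 *; set r := sin t in s2c2 *.
  move: s S C c r bE s2c2 => s S C c r bE s2c2.
  ring: bE s2c2.
Qed.

(** The first row of the eigenvalue equation. *)
Lemma mode1 (x1 t : R) :
  k1 * mode k1 k2 x1 t 1 = (band k1 k2 t - (k2 - x1)) * mode k1 k2 x1 t 0.
Proof. by rewrite /mode/= !mul1r !mul0r sin0; ring. Qed.

Lemma mode0_gt0 (x1 t : R) : 0 < t < pi -> 0 < mode k1 k2 x1 t 0.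
Proof.
move=> tpi; rewrite /mode/= mul1r mul0r sin0 !mulr0 subr0 add0r.
by rewrite !mulr_gt0// sin_gt0_pi.
Qed.

(** The left-hand side is the defect in the last row: that row differs from the recurrence,
    continued to index [2 n], exactly by this combination. The factor in front of [secular] is
    positive, so the right boundary condition holds iff [secular] vanishes. *)
Lemma mode_secular (x1 x2 t : R) (n : nat) : (0 < n)%N ->
  k2 * mode k1 k2 x1 t (2 * n) - (k2 - x2) * mode k1 k2 x1 t (2 * n).-1
  = (band k1 k2 t + k2 + k1 * cos t) / 2 * secular k1 k2 x1 x2 n t.
Proof.
case: n => // n _.
have bE := band_sqr k1_gt0 k12 t.
have s2c2 : sin t ^+ 2 = 1 - cos t ^+ 2 by exact: sin2cos2.
have D0 : band k1 k2 t + k2 + k1 * cos t != 0.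
  have := tan_half_arg_denom k1_gt0 k12 t.
  have : 0 < 2 * (k2 - k1) by rewrite mulr_gt0// subr_gt0.
  by move=> /lt_le_trans h /h /gt_eqF ->.
(* Half-angle identities: multiplying by the denominator of [T] turns [T ^+ 2] and [T] into
   expressions without [T], which clears it from the secular function. *)
have T2 : tan_half_arg k1 k2 t ^+ 2 * (band k1 k2 t + k2 + k1 * cos t) =
    band k1 k2 t - (k2 + k1 * cos t).
  apply: (mulIf D0); rewrite -mulrA -expr2 -exprMn divfK// exprMn s2c2.
  by ring: bE.
have T1 : tan_half_arg k1 k2 t * (band k1 k2 t + k2 + k1 * cos t) = k1 * sin t.
  by rewrite divfK.
have SE (m : nat) : sin (m.+1%:R * t) = sin (m%:R * t) * cos t + cos (m%:R * t) * sin t.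
  by rewrite -natr1 mulrDl mul1r sinD.
have SB : sin (n%:R * t) = sin (n.+1%:R * t) * cos t - cos (n.+1%:R * t) * sin t.
  by rewrite -sinB -natr1; congr sin; ring.
have -> : (2 * n.+1 = n.+1.*2)%N by rewrite mul2n.
rewrite /mode odd_double doubleK doubleS /= odd_double/= uphalf_double /secular.
rewrite (SE n.+1) SB.
set s := band _ _ _ in bE T1 T2 *; set T := tan_half_arg _ _ _ in T1 T2 *.
set S := sin (_ * t); set C := cos (_ * t).
set c := cos t in bE T1 T2 *; set r := sin t in T1 *.
move: s S C c r T bE T1 T2 {SE SB D0 s2c2} => s S C c r T bE T1 T2.
have -> : (s + k2 + k1 * c) / 2 *
  (S * (x1 * x2 - (2 * k2 - x1) * (2 * k2 - x2) * T ^+ 2) +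
   C * (x1 * (2 * k2 - x2) + x2 * (2 * k2 - x1)) * T) =
  (S * (x1 * x2 * (s + k2 + k1 * c) -
     (2 * k2 - x1) * (2 * k2 - x2) * (T ^+ 2 * (s + k2 + k1 * c))) +
   C * (x1 * (2 * k2 - x2) + x2 * (2 * k2 - x1)) * (T * (s + k2 + k1 * c))) / 2.
  by ring.
by rewrite T1 T2; field.
Qed.

(** As all links are nonzero, the first entry of an eigenvector determines the others, so
    eigenvectors are multiples of [mode]; only the last row remains as a condition. *)
Lemma eigenvalue_secular (x1 x2 t : R) (n : nat) : (0 < n)%N -> 0 < t < pi ->
  eigenvalue (chain_mx k1 k2 x1 x2 n) (band k1 k2 t - k1 - k2) <->
  secular k1 k2 x1 x2 n t = 0.
Proof.
move=> n0 tpi.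
have D0 : band k1 k2 t + k2 + k1 * cos t != 0.
  have := tan_half_arg_denom k1_gt0 k12 t.
  have : 0 < 2 * (k2 - k1) by rewrite mulr_gt0// subr_gt0.
  by move=> /lt_le_trans h /h /gt_eqF ->.
set s := band k1 k2 t; pose y := mode k1 k2 x1 t.
have y0 : y 0%N != 0 by rewrite gt_eqF// mode0_gt0.
have linkl : link k1 k2 (2 * n).-1 = k2.
  by rewrite /link; case: (n) n0 => // m _; rewrite mul2n doubleS/= odd_double.
have link0 i : link k1 k2 i != 0 by rewrite /link; case: ifP; rewrite gt_eqF.
have n2 : (1 < 2 * n)%N := leq_mul (leqnn 2) n0.
have lastP : secular k1 k2 x1 x2 n t = 0 <->
    link k1 k2 (2 * n).-2 * y (2 * n).-2 = (s - (k2 - x2)) * y (2 * n).-1.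
  have := mode_rec x1 t (2 * n).-2; rewrite -/y -/s.
  have -> : (2 * n).-2.+1 = (2 * n).-1 by case: (2 * n)%N n2 => [|[]].
  rewrite (prednK (ltnW n2)).
  rewrite linkl => yl.
  have := mode_secular x1 x2 t n0; rewrite -/y => ys.
  have -> : link k1 k2 (2 * n).-2 * y (2 * n).-2 = s * y (2 * n).-1 - k2 * y (2 * n)%N.
    by rewrite -yl addrK.
  split=> [F0|/eqP].
    by move/eqP: ys; rewrite F0 mulr0 subr_eq0 => /eqP ->; ring.
  rewrite mulrBl (inj_eq (addrI _)) eqr_opp => /eqP yE.
  move/eqP: ys; rewrite yE subrr eq_sym mulf_eq0 mulf_eq0 (negbTE D0)/=.
  by rewrite invr_eq0 pnatr_eq0/= => /eqP.
split.
- move=> /eigenvalueP[v vL v0].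
  pose f i := if insub i is Some j then v 0 j else 0.
  have vf (j : 'I_(2 * n)) : v 0 j = f j by rewrite /f valK.
  have E (i : 'I_(2 * n)) := chain_mx_mul x1 x2 i vf.
  have fy i : (i < 2 * n)%N -> f i = f 0%N / y 0%N * y i.
    have f1 : f 1%N = f 0%N / y 0%N * y 1%N.
      have := E (Ordinal (ltnW n2)); rewrite vL mxE vf/= n2 addr0 => e.
      apply: (mulfI (link0 0%N)).
      have -> : link k1 k2 0 * f 1%N = (s - (k2 - x1)) * f 0%N.
        by rewrite -[LHS](addKr (f 0%N * (- k1 - x1))) -e; ring.
      rewrite mulrCA mode1 -/y -/s mulrCA divfK//.
    elim/ltn_ind: i => -[|[|i]] IH i2n; [by rewrite divfK|by []|].
    apply: (mulfI (link0 i.+1)).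
    have i1n : (i.+1 < 2 * n)%N := ltnW i2n.
    have := E (Ordinal i1n); rewrite vL mxE vf/= i2n.
    rewrite ltn_eqF; last by rewrite -ltnS prednK// (ltn_trans _ n2).
    rewrite (IH i.+1)// (IH i) ?(ltnW i1n)//.
    set c := f 0%N / _ => e.
    have := mode_rec x1 t i; rewrite -/y -/s => ye.
    rewrite -[LHS](addKr (c * y i.+1 * (- k1 - k2) + link k1 k2 i * (c * y i))) -e.
    have -> : link k1 k2 i.+1 * (c * y i.+2) =
        c * (link k1 k2 i * y i + link k1 k2 i.+1 * y i.+2) - c * link k1 k2 i * y i.
      by ring.
    by rewrite ye; ring.
  have f0 : f 0%N != 0.
    apply: contra_neq v0 => f0; apply/rowP => j.
    by rewrite vf fy// f0 !mul0r mxE.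
  apply/lastP.
  have l2n : ((2 * n).-1 < 2 * n)%N by rewrite prednK// ltnW.
  have := E (Ordinal l2n); rewrite vL mxE vf/= prednK ?ltnn ?(ltnW n2)//.
  have l0 : (0 < (2 * n).-1)%N by rewrite -ltnS prednK// ltnW.
  rewrite addr0 eqxx l0 (gtn_eqF l0) (fy _ l2n) (fy (2 * n).-2); last first.
    exact: leq_ltn_trans (leq_pred _) l2n.
  set c := f 0%N / _ => e.
  have c0 : c != 0 by rewrite mulf_neq0// invr_eq0.
  apply: (mulfI c0); rewrite mulrCA.
  by rewrite -[LHS](addKr (c * y (2 * n).-1 * (- k1 - x2))) -e; ring.
- move=> /lastP ly; apply/eigenvalueP.
  pose v : 'rV[R]_(2 * n) := \row_j y j.
  have vf (j : 'I_(2 * n)) : v 0 j = y j by rewrite mxE.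
  exists v; last first.
    apply: contra_neq y0 => /rowP/(_ (Ordinal (ltnW n2))).
    by rewrite !mxE.
  apply/rowP => i; rewrite (chain_mx_mul x1 x2 i vf) mxE vf.
  have [i0|i0] := posnP i.
    rewrite i0/= n2 addr0.
    have -> : link k1 k2 0 * y 1%N = (s - (k2 - x1)) * y 0%N by exact: mode1.
    by ring.
  case: (ltnP i.+1 (2 * n)) => i2n.
    rewrite ltn_eqF; last by rewrite -ltnS prednK// ltnW.
    have := mode_rec x1 t i.-1; rewrite prednK// -/y -/s => e.
    by rewrite -addrA e; ring.
  have iE : (i : nat) = (2 * n).-1.
    by apply/eqP; rewrite eqn_leq -ltnS prednK ?ltn_ord ?(ltnW n2)//= -ltnS prednK ?(ltnW n2).
  by rewrite iE eqxx ly; ring.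
Qed.

End Spectrum.

(** * Enumeration of the zeros *)

Lemma sin_natpi (R : realType) (j : nat) : sin (j%:R * pi : R) = 0.
Proof.
elim: j => [|j IH]; first by rewrite mul0r sin0.
by rewrite -natr1 mulrDl mul1r sinDpi IH oppr0.
Qed.

Lemma sin_eq0_natpi (R : realType) (N : nat) (x : R) :
  0 <= x < N.+1%:R * pi -> sin x = 0 -> exists2 j, (j <= N)%N & x = j%:R * pi.
Proof.
elim: N x => [|N IH] x /andP[x0 xN] sx.
  exists 0%N => //; rewrite mul0r; apply/eqP; rewrite eq_le x0 andbT leNgt.
  by apply/negP => xp; move: sx; apply/eqP; rewrite gt_eqF// sin_gt0_pi// xp -[pi]mul1r.
have [xpi|xpi] := ltP x pi.
  by have [|j] := IH x _ sx; [rewrite x0/= (lt_le_trans xpi)// ler_peMl ?pi_ge0// ler1n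
    | exists j => //; exact: leqW].
have [||j jN xj] := IH (x - pi).
- by rewrite subr_ge0 xpi/= ltrBlDr -{2}[pi]mul1r -mulrDl natr1.
- by rewrite sinB sinpi cospi sx; ring.
- by exists j.+1 => //; rewrite -natr1 mulrDl mul1r -xj subrK.
Qed.

(** The dispersion relation maps []0, pi[] onto the acoustic band, so acoustic frequencies
    correspond to zeros of [secular]. *)
Lemma acousticP (R : realType) (k1 k2 x1 x2 : R) (n : nat) (w : R) :
  0 < k1 -> k1 < k2 -> (0 < n)%N ->
  acoustic k1 k2 x1 x2 n w <->
  exists t : R, [/\ 0 < t < pi, secular k1 k2 x1 x2 n t = 0 &
                w = Num.sqrt (k1 + k2 - band k1 k2 t)].
Proof.
move=> k10 k12 n0; split.
- move=> [[w0 ew] /andP[w20 w2k]].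
  have k20 : 0 < k2 by lra.
  have kk0 : 0 < 2 * k1 * k2 by rewrite !mulr_gt0.
  pose c := ((k1 + k2 - w ^+ 2) ^+ 2 - k1 ^+ 2 - k2 ^+ 2) / (2 * k1 * k2).
  (* After clearing denominators, [-1 < c] is [(2 k1 - w^2) (2 k2 - w^2) > 0] and [c < 1] is
     [w^2 (2 k1 + 2 k2 - w^2) > 0]. *)
  have c1 : -1 < c < 1.
    rewrite /c ltr_pdivrMr// ltr_pdivlMr//; apply/andP; split.
      have : 0 < (2 * k1 - w ^+ 2) * (2 * k2 - w ^+ 2) by apply: mulr_gt0; lra.
      by lra.
    have : 0 < w ^+ 2 * (2 * k1 + 2 * k2 - w ^+ 2) by apply: mulr_gt0; lra.
    by lra.
  have /andP[c1l c1r] := c1.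
  have tpi : 0 < acos c < pi by rewrite acos_gt0 ?acos_ltpi ?(ltW c1l) ?c1l ?(ltW c1r).
  have ct : cos (acos c) = c by rewrite acosK// in_itv/= !ltW.
  have bE : band k1 k2 (acos c) = k1 + k2 - w ^+ 2.
    rewrite /band ct /c mulrC divfK ?gt_eqF//.
    rewrite [X in Num.sqrt X](_ : _ = (k1 + k2 - w ^+ 2) ^+ 2); last by ring.
    by rewrite sqrtr_sqr ger0_norm//; lra.
  exists (acos c); split => //.
    apply/eigenvalue_secular => //; rewrite bE.
    by have -> : k1 + k2 - w ^+ 2 - k1 - k2 = - w ^+ 2 by ring.
  rewrite bE; have -> : k1 + k2 - (k1 + k2 - w ^+ 2) = w ^+ 2 by ring.
  by rewrite sqrtr_sqr ger0_norm.
- move=> [t [tpi st ->]]; have /andP[t0 tp] := tpi.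
  have bl : band k1 k2 t < k1 + k2 by apply: band_lt; rewrite // t0 ltW.
  have bg : k2 - k1 < band k1 k2 t by apply: band_gt; rewrite // tp ltW.
  rewrite /acoustic /eigenfrequencies /= sqrtr_ge0 sqr_sqrtr; last by lra.
  split; last by apply/andP; split; lra.
  split => //; have -> : - (k1 + k2 - band k1 k2 t) = band k1 k2 t - k1 - k2 by ring.
  exact/eigenvalue_secular.
Qed.

Lemma theta_dispersion (R : realType) (k1 k2 x1 x2 : R) (n j : nat) (t : R) :
  0 < k1 -> k1 < k2 -> 0 < t < pi ->
  omega k1 k2 x1 x2 n j = Num.sqrt (k1 + k2 - band k1 k2 t) ->
  theta k1 k2 x1 x2 n j = t.
Proof.
move=> k10 k12 tpi wE; have /andP[t0 tp] := tpi.
have w2 : omega k1 k2 x1 x2 n j ^+ 2 = k1 + k2 - band k1 k2 t.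
  by rewrite wE sqr_sqrtr// subr_ge0 band_le.
apply: xget_unique => [|u] /=; first by split.
move=> [/andP[u0 up]]; rewrite w2 -/(band k1 k2 u) => /(addrI _)/oppr_inj bE.
have [ut|tu|//] := ltgtP u t.
- by have := lt_band k10 k12 (ltW u0) ut (ltW tp); rewrite bE ltxx.
- by have := lt_band k10 k12 (ltW t0) tu (ltW up); rewrite bE ltxx.
Qed.

(** Frequencies increase with [t], so an increasing enumeration of all zeros of [secular] is also
    the labelling of the [theta]s, counted down from [2 n]. *)
Lemma theta_enum (R : realType) (k1 k2 x1 x2 : R) (n N : nat) (z : nat -> R) :
  0 < k1 -> k1 < k2 -> (0 < n)%N -> (N <= 2 * n)%N ->
  (forall i j, (0 < i < j)%N -> (j <= N)%N -> z i < z j) ->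
  (forall j, (0 < j <= N)%N -> 0 < z j < pi /\ secular k1 k2 x1 x2 n (z j) = 0) ->
  (forall t : R, 0 < t < pi -> secular k1 k2 x1 x2 n t = 0 ->
     exists2 j, (0 < j <= N)%N & t = z j) ->
  n2 k1 k2 x1 x2 n = N /\
  forall j, (0 < j <= N)%N -> theta k1 k2 x1 x2 n (2 * n - j + 1) = z j.
Proof.
move=> k10 k12 n0 N2n z_mono z_zero z_all.
pose w j := Num.sqrt (k1 + k2 - band k1 k2 (z j)).
pose s := [seq w j | j <- iota 1 N].
have acE x : acoustic k1 k2 x1 x2 n x <-> x \in s.
  split=> [/(acousticP _ _ _ k10 k12 n0)[t [tpi st ->]]|].
    have [j jN ->] := z_all t tpi st.
    by apply/mapP; exists j => //; rewrite mem_iota add1n.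
  move=> /mapP[j]; rewrite mem_iota add1n ltnS => jN ->.
  apply/(acousticP _ _ _ k10 k12 n0); exists (z j).
  by have [] := z_zero j jN.
have ac_fin : finite_set (acoustic k1 k2 x1 x2 n).
  by apply/finite_seqP; exists s; apply/seteqP; split=> x /acE.
have s_sorted : sorted <%R s.
  rewrite sorted_map; apply: (@sub_in_sorted _ [pred j | 0 < j <= N]%N ltn) => /=.
  - move=> i j /andP[i0 iN] /andP[j0 jN] ij.
    have /(_ i) [] := z_zero; first by rewrite i0.
    have /(_ j) [] := z_zero; first by rewrite j0.
    move=> /andP[zj0 zjp] _ /andP[zi0 zip] _.
    have zij : z i < z j by apply: z_mono => //; rewrite i0.
    have bj : band k1 k2 (z j) < band k1 k2 (z i) by apply: lt_band => //; exact: ltW.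
    have bi : band k1 k2 (z i) <= k1 + k2 by exact: band_le.
    by rewrite /w ltr_sqrt; lra.
  - by apply/allP => j; rewrite mem_iota add1n ltnS.
  - exact: iota_ltn_sorted.
have s_sort : sort <=%R (enum_fset (fset_set (acoustic k1 k2 x1 x2 n))) = s.
  apply: lt_sorted_eq => //; first by rewrite sort_lt_sorted fset_uniq.
  move=> x; rewrite mem_sort; apply/idP/idP.
    by move=> xA; apply/acE; have : x \in fset_set (acoustic k1 k2 x1 x2 n) by [];
       rewrite in_fset_set// inE.
  move=> /acE xA; suff : x \in fset_set (acoustic k1 k2 x1 x2 n) by [].
  by rewrite in_fset_set// inE.
split.
  by rewrite /n2 -(size_sort <=%R) s_sort size_map size_iota.
move=> j jN; have /andP[j0 jN'] := jN.
have [zj _] := z_zero j jN.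
apply: theta_dispersion => //.
rewrite /omega s_sort.
have j2n : (j <= 2 * n)%N := leq_trans jN' N2n.
rewrite addn1 ltn_subrL j0 muln_gt0 n0/=.
(* The [j]-th zero sits at position [j - 1] of the sorted list, as [nth] counts from 0. *)
have -> : (2 * n - (2 * n - j).+1 = j.-1)%N by rewrite subnS subKn.
by rewrite (nth_map 0%N) ?size_iota ?prednK// nth_iota ?prednK// add1n prednK.
Qed.

(* The phase [Phi t = n t + beta pi + e t] increases from [(0, pi)] to
   [(N pi, (N + 1) pi)] on [[a, pi - a]], so that the zeros are the points where
   it takes the values [pi, ..., N pi]. *)
Lemma theta_estimate (R : realType) (k1 k2 x1 x2 : R) (n N : nat) (beta eps : R)
    (e : R -> R) (a := (4 * n%:R)^-1) :
  0 < k1 -> k1 < k2 -> (0 < n)%N -> 0 <= beta <= 1 / 2 ->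
  N%:R = n%:R - 1 + 2 * beta -> 0 < eps <= 1 / 2 ->
  (forall t : R, 0 < t < pi -> secular k1 k2 x1 x2 n t = 0 -> a <= t <= pi - a) ->
  (forall t : R, a <= t <= pi - a ->
     secular k1 k2 x1 x2 n t = 0 <-> sin (n%:R * t + beta * pi + e t) = 0) ->
  (forall t : R, a <= t <= pi - a -> `|e t| <= eps * n%:R * Num.min t (pi - t)) ->
  (forall t u : R, a <= t <= pi - a -> a <= u <= pi - a ->
     `|e t - e u| <= eps * n%:R * `|t - u|) ->
  forall k, (0 < k <= N)%N ->
  let t := theta k1 k2 x1 x2 n (2 * n - k + 1) in
  let u := pi - theta k1 k2 x1 x2 n (2 * n - n2 k1 k2 x1 x2 n + k) in
  (0 < t /\ `|n%:R * t - (k%:R - beta) * pi| <= eps * (n%:R * t)) /\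
  (0 < u /\ `|n%:R * u - (k%:R - beta) * pi| <= eps * (n%:R * u)).
Proof.
move=> k10 k12 n0 /andP[beta0 beta1] NE /andP[eps0 eps1] inside zeroE e_small e_lip.
have n1 : 1 <= n%:R :> R by rewrite ler1n.
have npos : 0 < n%:R :> R by rewrite ltr0n.
have a0 : 0 < a by rewrite invr_gt0 mulr_gt0.
have na : n%:R * a = 1 / 4 by rewrite /a; field; rewrite gt_eqF.
have a4 : a <= 1 / 4 by rewrite -na ler_peMl// ltW.
have pi2 : 2 <= pi :> R := pi_ge2 R.
have nN : (N <= 2 * n)%N by rewrite -(ler_nat R) NE natrM; lra.
pose Phi (t : R) := n%:R * t + beta * pi + e t.
have bpi0 : 0 <= beta * pi by rewrite mulr_ge0 ?pi_ge0.
have bpi1 : 2 * (beta * pi) <= pi.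
  by rewrite mulrA ler_piMl ?pi_ge0//; lra.
have e_bound (t : R) : a <= t <= pi - a ->
    `|e t| <= eps * (n%:R * t) /\ `|e t| <= eps * (n%:R * (pi - t)).
  move=> tab; split; apply: le_trans (e_small t tab) _;
    by rewrite -mulrA ler_pM2l// ler_pM2l// ge_min lexx ?orbT.
have en0 : 0 <= eps * n%:R by rewrite mulr_ge0// ltW.
(* The slope [n] of the main term beats the Lipschitz constant [eps n <= n / 2] of [e]. *)
have Phi_lt (t u : R) : a <= t <= pi - a -> a <= u <= pi - a -> t < u -> Phi t < Phi u.
  move=> tab uab tu; have := e_lip t u tab uab.
  rewrite distrC ler_norml distrC gtr0_norm ?subr_gt0// => /andP[h _].
  have : eps * n%:R * (u - t) < n%:R * (u - t).
    by rewrite ltr_pM2r ?subr_gt0// gtr_pMl//; lra.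
  by rewrite /Phi; lra.
have Phi_inj (t u : R) : a <= t <= pi - a -> a <= u <= pi - a -> Phi t = Phi u -> t = u.
  move=> tab uab E; have [tu|ut|//] := ltgtP t u.
    by have := Phi_lt _ _ tab uab tu; rewrite E ltxx.
  by have := Phi_lt _ _ uab tab ut; rewrite E ltxx.
have aab : a <= a <= pi - a by apply/andP; split; lra.
have bab : a <= pi - a <= pi - a by apply/andP; split; lra.
(* At both ends of the interval [|e|] is at most [eps / 4 <= 1 / 8], less than the distance to the
   neighbouring multiples of [pi]. *)
have [Phia0 Phia1] : 0 < Phi a /\ Phi a < pi.
  have [+ _] := e_bound a aab; rewrite na ler_norml => /andP[h1 h2].
  by rewrite /Phi na; split; lra.
have N1E : N.+1%:R * pi = n%:R * pi + 2 * (beta * pi) :> R.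
  by rewrite -natr1 NE; ring.
have NpE : N%:R * pi = n%:R * pi + 2 * (beta * pi) - pi :> R by rewrite NE; ring.
have [Phib0 Phib1] : N%:R * pi < Phi (pi - a) /\ Phi (pi - a) < N.+1%:R * pi.
  have [_ +] := e_bound _ bab; rewrite subKr na ler_norml => /andP[h1 h2].
  by rewrite /Phi mulrBr na N1E NpE; split; lra.
have Phi_cont : {within `[a, pi - a], continuous Phi}.
  apply: (@lipschitz_continuous_cc _ _ _ _ (n%:R + eps * n%:R)) => t u tab uab.
  have -> : Phi t - Phi u = n%:R * (t - u) + (e t - e u) by rewrite /Phi; ring.
  rewrite (le_trans (ler_normD _ _))// mulrDl lerD ?e_lip//.
  by rewrite normrM gtr0_norm.
have /choice[z zP] (j : nat) : exists zj : R, (0 < j <= N)%N ->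
    a <= zj <= pi - a /\ Phi zj = j%:R * pi.
  have [jN|] := boolP (0 < j <= N)%N; last by exists 0.
  have /andP[j0 jN'] := jN.
  have jp1 : pi <= j%:R * pi :> R by rewrite ler_peMl ?pi_ge0// ler1n.
  have jpN : j%:R * pi <= N%:R * pi :> R by rewrite ler_pM2r ?pi_gt0// ler_nat.
  have [||c] := @IVT _ Phi a (pi - a) (j%:R * pi) _ Phi_cont; first by lra.
    by rewrite ge_min le_max; apply/andP; split; apply/orP; [left|right]; lra.
  by rewrite in_itv/= => cab Phic; exists c.
have z_mono i j : (0 < i < j)%N -> (j <= N)%N -> z i < z j.
  move=> /andP[i0 ij] jN.
  have [zi Pi] : a <= z i <= pi - a /\ Phi (z i) = i%:R * pi.
    by apply: zP; rewrite i0 (leq_trans (ltnW ij)).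
  have [zj Pj] : a <= z j <= pi - a /\ Phi (z j) = j%:R * pi.
    by apply: zP; rewrite jN (ltn_trans i0).
  have Pij : Phi (z i) < Phi (z j) by rewrite Pi Pj ltr_pM2r ?pi_gt0// ltr_nat.
  have [//|ji|E] := ltgtP (z i) (z j); last by rewrite E ltxx in Pij.
  by have := lt_trans Pij (Phi_lt _ _ zj zi ji); rewrite ltxx.
have z_zero j : (0 < j <= N)%N -> 0 < z j < pi /\ secular k1 k2 x1 x2 n (z j) = 0.
  move=> jN; have [zj Pj] := zP j jN; split.
    by have /andP[? ?] := zj; apply/andP; split; lra.
  by apply/zeroE => //; rewrite -/(Phi _) Pj sin_natpi.
have z_all (t : R) : 0 < t < pi -> secular k1 k2 x1 x2 n t = 0 ->
    exists2 j, (0 < j <= N)%N & t = z j.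
  move=> tpi st; have tab := inside t tpi st.
  have /zeroE := st; rewrite -/(Phi t) => /(_ tab) sP.
  have Pat : Phi a <= Phi t.
    have /andP[+ _] := tab; rewrite le_eqVlt => /predU1P[<-//|/Phi_lt h].
    by rewrite ltW// h.
  have Ptb : Phi t <= Phi (pi - a).
    have /andP[_ +] := tab; rewrite le_eqVlt => /predU1P[<-//|/Phi_lt h].
    by rewrite ltW// h.
  have [|j jN Pj] := @sin_eq0_natpi _ N (Phi t) _ sP.
    by apply/andP; split; lra.
  have j0 : (0 < j)%N.
    by rewrite lt0n; apply/eqP => j0; move: Pj; rewrite j0 mul0r; lra.
  have jN' : (0 < j <= N)%N by rewrite j0.
  exists j => //; have [zj zPj] := zP j jN'.
  by apply: Phi_inj => //; rewrite zPj.
have [n2E thetaE] := theta_enum k10 k12 n0 nN z_mono z_zero z_all.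
move=> k kN /=; have /andP[k0 kN'] := kN.
rewrite n2E (thetaE k kN).
(* The [k]-th frequency from the top is the [(N + 1 - k)]-th from the bottom. *)
have -> : (2 * n - N + k = 2 * n - (N.+1 - k) + 1)%N.
  rewrite subSn// addn1 subnS prednK; last by rewrite subn_gt0 (leq_trans _ nN)// ltn_subrL k0 (leq_trans k0).
  by rewrite subnBA// addnC addnBA// addnC.
have kN2 : (0 < N.+1 - k <= N)%N by rewrite subn_gt0 ltnS kN' leq_subLR -addn1 addnC leq_add2r.
rewrite (thetaE _ kN2).
split.
  have [zk Pk] := zP k kN; have [eb _] := e_bound _ zk.
  split; first by have /andP[? ?] := zk; lra.
  rewrite -normrN; apply: le_trans eb.
  by rewrite le_eqVlt; apply/orP; left; apply/eqP; congr (`|_|); rewrite mulrBl -Pk /Phi; ring.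
have [zk Pk] := zP _ kN2; have [_ eb] := e_bound _ zk.
split; first by have /andP[? ?] := zk; lra.
apply: le_trans eb; rewrite le_eqVlt; apply/orP; left; apply/eqP; congr (`|_|).
(* Since [(N + 1) pi = n pi + 2 beta pi], reflecting [t] to [pi - t] leaves the same shift [beta]:
   here [n (pi - z) - (k - beta) pi] equals [e z]. *)
move: Pk; rewrite natrB ?(leqW kN')// mulrBl N1E /Phi => Pk.
have -> : e (z (N.+1 - k)%N) =
  n%:R * pi + 2 * (beta * pi) - k%:R * pi - n%:R * z (N.+1 - k)%N - beta * pi.
  by rewrite -Pk; ring.
by ring.
Qed.

(** * Phase shifts of the end springs *)

Lemma min_pi_ge (R : realType) (a t : R) : a <= t <= pi - a -> a <= Num.min t (pi - t).
Proof. by move=> /andP[? ?]; rewrite le_min; apply/andP; split; lra. Qed.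

Lemma mulf_eq0_iff (R : idomainType) (c x : R) : c != 0 -> x = 0 <-> c * x = 0.
Proof.
by move=> c0; split=> [->|/eqP]; [rewrite mulr0|rewrite mulf_eq0 (negbTE c0) => /eqP].
Qed.

(* [atan (r T)] with [r = 2 k2 / x - 1] is the phase shift produced by an end
   spring [x > 0]. *)
Lemma secular_phase (R : realType) (k1 k2 x1 x2 t : R) (n : nat) (beta := 0 : R)
    (T := tan_half_arg k1 k2 t) :
  0 < x1 -> 0 < x2 ->
  secular k1 k2 x1 x2 n t = 0 <->
  sin (n%:R * t + beta * pi +
       (atan ((2 * k2 - x1) / x1 * T) + atan ((2 * k2 - x2) / x2 * T))) = 0.
Proof.
move=> x10 x20; rewrite mul0r addr0.
set A := atan _; set B := atan _.
have cA : cos A != 0 by rewrite gt_eqF// cos_atan_gt0.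
have cB : cos B != 0 by rewrite gt_eqF// cos_atan_gt0.
have -> : sin (n%:R * t + (A + B)) =
    cos A * cos B / (x1 * x2) * secular k1 k2 x1 x2 n t.
  rewrite sinD sinD cosD !sin_atan -/A -/B /secular -/T.
  by field; rewrite !gt_eqF.
by apply: mulf_eq0_iff; rewrite !mulf_neq0// invr_eq0 mulf_neq0// gt_eqF.
Qed.

(** Only the left end is turned into a phase shift. On the right the division is by [2 k2 - x2] and
    [T] instead of [x2], so [x2 = 0] is allowed. *)
Lemma secular_soft_end (R : realType) (k1 k2 x1 x2 t : R) (n : nat)
    (T := tan_half_arg k1 k2 t) (X := n%:R * t + atan ((2 * k2 - x1) / x1 * T)) :
  0 < x1 -> x2 < 2 * k2 -> 0 < T ->
  secular k1 k2 x1 x2 n t = 0 <-> cos X + x2 / (2 * k2 - x2) / T * sin X = 0.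
Proof.
move=> x10 x2k T0; have m20 : 0 < 2 * k2 - x2 by rewrite subr_gt0.
have cA := cos_atan_gt0 ((2 * k2 - x1) / x1 * T).
have -> : cos X + x2 / (2 * k2 - x2) / T * sin X =
    cos (atan ((2 * k2 - x1) / x1 * T)) / (x1 * (2 * k2 - x2) * T) *
    secular k1 k2 x1 x2 n t.
  rewrite /X cosD sinD !sin_atan /secular -/T.
  by field; rewrite !gt_eqF.
by apply: mulf_eq0_iff; rewrite gt_eqF// divr_gt0// mulr_gt0// mulr_gt0.
Qed.

(** The shift of a soft right end is close to a quarter turn: [beta = 1 / 2] absorbs [pi / 2], and
    the complementary angle [atan (x2 / (2 k2 - x2) / T)] is what remains as error. *)
Lemma secular_phase_soft_end (R : realType) (k1 k2 x1 x2 t : R) (n : nat)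
    (beta := 1 / 2 : R) (T := tan_half_arg k1 k2 t) :
  0 < x1 -> x2 < 2 * k2 -> 0 < T ->
  secular k1 k2 x1 x2 n t = 0 <->
  sin (n%:R * t + beta * pi +
       (atan ((2 * k2 - x1) / x1 * T) - atan (x2 / (2 * k2 - x2) / T))) = 0.
Proof.
move=> x10 x2k T0; apply: (iff_trans (secular_soft_end n x10 x2k T0)); rewrite -/T.
set A := atan (_ * T); set u := _ / T.
have -> : n%:R * t + beta * pi + (A - atan u) = (n%:R * t + A - atan u) + pi / 2.
  by rewrite /beta; field.
rewrite sinDpihalf cosB sin_atan.
have -> : cos (n%:R * t + A) * cos (atan u) + sin (n%:R * t + A) * (u * cos (atan u))
  = cos (atan u) * (cos (n%:R * t + A) + u * sin (n%:R * t + A)) by ring.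
by apply: mulf_eq0_iff; rewrite gt_eqF// cos_atan_gt0.
Qed.

Lemma sin_natpi_sub (R : realType) (n : nat) (y : R) :
  sin (n%:R * pi - y) = - (cos (n%:R * pi) * sin y).
Proof. by rewrite sinB sin_natpi; ring. Qed.

Lemma cos_natpi_neq0 (R : realType) (n : nat) : cos (n%:R * pi : R) != 0.
Proof.
by rewrite -norm_sin_eq1; apply/negP => /eqP h; have := h; rewrite sin_natpi normr0 => /esym/eqP; rewrite oner_eq0.
Qed.

(** Case [beta = 0], [N = n - 1]. As [atan] is 1-Lipschitz, [C (|r1| + |r2|)] controls both the size
    of the error relative to [min (t, pi - t)] and its Lipschitz constant. *)
Lemma theta_estimate_stiff (R : realType) (k1 k2 C x1 x2 : R) (n : nat) (eps : R) :
  0 < k1 -> k1 < k2 -> 1 <= C ->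
  (forall t : R, 0 <= t <= pi -> tan_half_arg k1 k2 t <= C * Num.min t (pi - t)) ->
  (forall t u : R, `|tan_half_arg k1 k2 t - tan_half_arg k1 k2 u| <= C * `|t - u|) ->
  (0 < n)%N -> 0 < eps <= 1 / 2 -> 0 < x1 -> 0 < x2 ->
  C * (`|(2 * k2 - x1) / x1| + `|(2 * k2 - x2) / x2|) <= eps * n%:R ->
  forall k, (0 < k <= n.-1)%N ->
  let t := theta k1 k2 x1 x2 n (2 * n - k + 1) in
  let u := pi - theta k1 k2 x1 x2 n (2 * n - n2 k1 k2 x1 x2 n + k) in
  (0 < t /\ `|n%:R * t - (k%:R - 0) * pi| <= eps * (n%:R * t)) /\
  (0 < u /\ `|n%:R * u - (k%:R - 0) * pi| <= eps * (n%:R * u)).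
Proof.
move=> k10 k12 C1 TC TL n0 epsP x10 x20.
set r1 := _ / x1; set r2 := _ / x2 => rC.
have n1 : 1 <= n%:R :> R by rewrite ler1n.
have [eps0 eps1] := andP epsP.
pose T := tan_half_arg k1 k2.
pose e (t : R) := atan (r1 * T t) + atan (r2 * T t).
have pi2 : 2 <= pi :> R := pi_ge2 R.
have rT (t u : R) : `|atan (r1 * t) - atan (r1 * u)| + `|atan (r2 * t) - atan (r2 * u)|
    <= (`|r1| + `|r2|) * `|t - u|.
  by rewrite mulrDl -!normrM !mulrBr lerD// atan_lipschitz.
have r0 : 0 <= `|r1| + `|r2| by rewrite addr_ge0.
have e_small (t : R) : 0 < t < pi -> `|e t| <= eps * n%:R * Num.min t (pi - t).
  move=> tpi; have /andP[t0 tp] := tpi.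
  have m0 : 0 <= Num.min t (pi - t) by rewrite le_min subr_ge0 !ltW.
  have T0 := tan_half_arg_gt0 k10 k12 tpi.
  have := rT (T t) 0; rewrite !mulr0 atan0 !subr0 => /(le_trans (ler_normD _ _)).
  move=> /le_trans; apply; rewrite (gtr0_norm T0).
  apply: (@le_trans _ _ ((`|r1| + `|r2|) * (C * Num.min t (pi - t)))).
    by rewrite ler_wpM2l// TC// !ltW.
  by rewrite mulrCA mulrA ler_wpM2r.
apply: (theta_estimate (e := e) k10 k12 n0 _ _ epsP).
- by rewrite lexx/=; lra.
- by rewrite -{2}(prednK n0) -natr1; ring.
(* Closer than [1 / (4 n)] to 0, the error is at most half of [n t], so the phase lies strictly
   between 0 and [pi]; near [pi] the same holds for [n pi] minus the phase. *)
- move=> t tpi st; have /andP[t0 tp] := tpi.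
  have := e_small t tpi; set m := Num.min _ _ => et.
  have [mt mp] : m <= t /\ m <= pi - t by rewrite /m !ge_min !lexx orbT.
  have en0 : 0 <= eps * n%:R by rewrite mulr_ge0// ltW// (lt_le_trans _ n1).
  have m0 : 0 < m by rewrite lt_min subr_gt0 t0.
  have emn : eps * n%:R * m <= n%:R * m / 2.
    by have : eps * (n%:R * m) <= 1 / 2 * (n%:R * m); [rewrite ler_wpM2r// mulr_ge0// ltW|lra].
  have nm0 : 0 < n%:R * m by rewrite mulr_gt0// (lt_le_trans _ n1).
  have [nmt nmp] : n%:R * m <= n%:R * t /\ n%:R * m <= n%:R * (pi - t).
    by rewrite !ler_wpM2l ?ler0n.
  have /secular_phase := st => /(_ x10 x20); rewrite -/r1 -/r2 -/(T t) -/(e t) => sP.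
  move: et; rewrite ler_norml => /andP[el er].
  rewrite !leNgt; apply/andP; split; apply/negP => ta.
    have na : n%:R * t < 1 / 4.
      by rewrite -ltr_pdivlMl ?(lt_le_trans _ n1)// mul1r -invfM mulrC.
    move: sP; apply/eqP; rewrite gt_eqF// sin_gt0_pi//.
    by apply/andP; split; lra.
  have na : n%:R * (pi - t) < 1 / 4.
    rewrite -ltr_pdivlMl ?(lt_le_trans _ n1)// mul1r -invfM mulrC; lra.
  have : sin (n%:R * (pi - t) - e t) = 0.
    move: sP; have -> : n%:R * t + 0 * pi + e t =
      n%:R * pi - (n%:R * (pi - t) - e t) by ring.
    rewrite sin_natpi_sub => /eqP; rewrite oppr_eq0 mulf_eq0.
    by rewrite (negbTE (cos_natpi_neq0 _ _))/= => /eqP.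
  by apply/eqP; rewrite gt_eqF// sin_gt0_pi//; apply/andP; split; lra.
- by move=> t _; exact: secular_phase.
- move=> t tab; apply: e_small; have : 0 < (4 * n%:R)^-1 :> R.
    by rewrite invr_gt0 mulr_gt0// (lt_le_trans _ n1).
  by move: tab => /andP[? ?] ?; apply/andP; split; lra.
- move=> t u _ _; apply: le_trans (_ : (`|r1| + `|r2|) * `|T t - T u| <= _).
    apply: le_trans (rT _ _); rewrite /e opprD addrACA; exact: ler_normD.
  apply: (@le_trans _ _ ((`|r1| + `|r2|) * (C * `|t - u|))).
    by rewrite ler_wpM2l// TL.
  by rewrite mulrCA mulrA ler_wpM2r.
Qed.

(** Case [beta = 1 / 2], [N = n], with half of [eps] for each end. On [[a, pi - a]] one has
    [1 / T <= 4 n C], so [rho / T] has Lipschitz constant at most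
    [rho (4 n C)^2 C = 32 C^3 rho n (n / 2)]; this is the origin of the factor [32 C^3]. *)
Lemma theta_estimate_soft (R : realType) (k1 k2 C x1 x2 : R) (n : nat) (eps : R)
    (rho := x2 / (2 * k2 - x2)) :
  0 < k1 -> k1 < k2 -> 1 <= C ->
  (forall t : R, 0 <= t <= pi -> tan_half_arg k1 k2 t <= C * Num.min t (pi - t)) ->
  (forall t : R, 0 <= t <= pi -> Num.min t (pi - t) <= C * tan_half_arg k1 k2 t) ->
  (forall t u : R, `|tan_half_arg k1 k2 t - tan_half_arg k1 k2 u| <= C * `|t - u|) ->
  (0 < n)%N -> 0 < eps <= 1 / 2 -> 0 < x1 -> 0 <= x2 < 2 * k2 ->
  C * `|(2 * k2 - x1) / x1| <= eps / 2 * n%:R ->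
  32 * C ^+ 3 * rho * n%:R <= eps ->
  forall k, (0 < k <= n)%N ->
  let t := theta k1 k2 x1 x2 n (2 * n - k + 1) in
  let u := pi - theta k1 k2 x1 x2 n (2 * n - n2 k1 k2 x1 x2 n + k) in
  (0 < t /\ `|n%:R * t - (k%:R - 1 / 2) * pi| <= eps * (n%:R * t)) /\
  (0 < u /\ `|n%:R * u - (k%:R - 1 / 2) * pi| <= eps * (n%:R * u)).
Proof.
move=> k10 k12 C1 TC TC' TL n0 epsP x10 /andP[x20 x2k].
set r1 := _ / x1 => rC rhoC.
have n1 : 1 <= n%:R :> R by rewrite ler1n.
have npos : 0 < n%:R :> R by rewrite ltr0n.
have Cpos : 0 < C by rewrite (lt_le_trans _ C1).
have [eps0 eps1] := andP epsP.
have rho0 : 0 <= rho by rewrite divr_ge0// subr_ge0 ltW.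
pose T := tan_half_arg k1 k2.
pose e (t : R) := atan (r1 * T t) - atan (rho / T t).
have pi2 : 2 <= pi :> R := pi_ge2 R.
set a := (4 * n%:R)^-1 : R.
have a0 : 0 < a by rewrite invr_gt0 mulr_gt0.
have na : n%:R * a = 1 / 4 by rewrite /a; field; rewrite gt_eqF.
have a4 : a <= 1 / 4 by rewrite -na ler_peMl// ltW.
have rhoC1 : 32 * C * rho * n%:R <= eps.
  apply: le_trans rhoC; rewrite !ler_wpM2r ?ler0n//.
  by rewrite ler_pM2l// -[leLHS]expr1 ler_weXn2l.
have in_pi (t : R) : a <= t <= pi - a -> 0 < t < pi.
  by move=> /andP[? ?]; apply/andP; split; lra.
have T_gt0 (t : R) : 0 < t < pi -> 0 < T t by exact: tan_half_arg_gt0.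
have g_small (t : R) : 0 < t < pi -> `|atan (r1 * T t)| <= eps / 2 * n%:R * Num.min t (pi - t).
  move=> tpi; have /andP[t0 tp] := tpi.
  have m0 : 0 <= Num.min t (pi - t) by rewrite le_min subr_ge0 !ltW.
  apply: le_trans (norm_atan_le _) _; rewrite normrM (gtr0_norm (T_gt0 _ tpi)).
  apply: (@le_trans _ _ (`|r1| * (C * Num.min t (pi - t)))).
    by rewrite ler_wpM2l// TC// !ltW.
  by rewrite mulrCA mulrA ler_wpM2r.
have u_small (t : R) : 0 < t < pi -> rho / T t * Num.min t (pi - t) <= C * rho.
  move=> tpi; have /andP[t0 tp] := tpi.
  rewrite mulrAC ler_pdivrMr ?T_gt0// (mulrC C) -[leRHS]mulrA ler_wpM2l//.
  by apply: TC'; rewrite !ltW.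
apply: (theta_estimate (e := e) k10 k12 n0 _ _ epsP).
- by apply/andP; split; lra.
- by field.
(* Near the ends [rho / T] need not be small, so the phase form is avoided. Near 0,
   [cos X + u sin X] is positive. Near [pi], a zero would give [cos y = u sin y] with
   [0 < y < 3 / 8], but [cos y >= 1 - y > 5 / 8] while [u sin y <= 2 n C rho <= 1 / 4]. *)
- move=> t tpi st; rewrite -/a; have /andP[t0 tp] := tpi.
  have := g_small t tpi; have := u_small t tpi; set m := Num.min _ _ => ut gt.
  have [mt mp] : m <= t /\ m <= pi - t by rewrite /m !ge_min !lexx orbT.
  have m0 : 0 < m by rewrite lt_min subr_gt0 t0.
  have nm0 : 0 < n%:R * m by rewrite mulr_gt0.
  have emn : eps / 2 * n%:R * m <= n%:R * m / 2.
    by have : eps * (n%:R * m) <= 1 / 2 * (n%:R * m); [rewrite ler_wpM2r// mulr_ge0// ltW|move: nm0; lra].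
  have [nmt nmp] : n%:R * m <= n%:R * t /\ n%:R * m <= n%:R * (pi - t).
    by rewrite !ler_wpM2l ?ler0n.
  have /secular_soft_end := st => /(_ x10 x2k (T_gt0 _ tpi)).
  rewrite -/r1 -/(T t) -/rho; set g := atan _ in gt *; set u := _ / _ in ut *.
  have u0 : 0 <= u by rewrite divr_ge0// ltW// T_gt0.
  move: gt; rewrite ler_norml => /andP[gl gr].
  rewrite !leNgt => sP; apply/andP; split; apply/negP => ta.
    have nta : n%:R * t < 1 / 4 by rewrite -na ltr_pM2l.
    have : 0 < cos (n%:R * t + g) + u * sin (n%:R * t + g).
      rewrite ltr_pwDl//; last by rewrite mulr_ge0// sin_ge0_pi//; apply/andP; split; lra.
      by apply: cos_gt0_pihalf; apply/andP; split; lra.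
    by rewrite sP ltxx.
  have nta : n%:R * (pi - t) < 1 / 4 by rewrite -na ltr_pM2l//; lra.
  pose y := n%:R * (pi - t) - g.
  have y0 : 0 < y by rewrite /y; lra.
  have y1 : y < 3 / 8 by rewrite /y; lra.
  have yE : n%:R * t + g = n%:R * pi - y by rewrite /y; ring.
  have cuy : cos y = u * sin y.
    apply: (mulfI (cos_natpi_neq0 R n)); move/eqP: sP.
    rewrite yE sin_natpi_sub cosB sin_natpi mul0r addr0 mulrN subr_eq0 => /eqP ->.
    by ring.
  have mE : m = pi - t by apply/min_idPr; move: ta; lra.
  have uy : u * sin y <= 1 / 4.
    apply: (@le_trans _ _ (u * y)).
      rewrite ler_wpM2l// (le_trans (ler_norm _))// (le_trans (norm_sin_le _))//.
      by rewrite gtr0_norm.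
    apply: (@le_trans _ _ (u * (n%:R * m * 2))).
      by rewrite ler_wpM2l// /y; move: gl emn nm0; rewrite mE; lra.
    have -> : u * (n%:R * m * 2) = 2 * n%:R * (u * m) by ring.
    apply: (@le_trans _ _ (2 * n%:R * (C * rho))).
      by rewrite ler_wpM2l// mulr_ge0.
    by lra.
  have := cos_lipschitz y 0; rewrite cos0 subr0 (gtr0_norm y0) ler_norml => /andP[cy _].
  by move: cy; rewrite cuy; lra.
- by move=> t /in_pi tpi; apply: secular_phase_soft_end => //; exact: T_gt0.
- move=> t tab; have tpi := in_pi t tab.
  have := g_small t tpi; have := u_small t tpi; have := min_pi_ge tab.
  set m := Num.min _ _ => am ut gt.
  have m0 : 0 < m := lt_le_trans a0 am.
  rewrite (le_trans (ler_normB _ _))//.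
  have u0 : 0 <= rho / T t by rewrite divr_ge0// ltW// T_gt0.
  (* Multiplied by [m >= a], this follows from [C rho <= eps / (32 n) = eps / 2 * n * a^2]. *)
  have um : rho / T t <= eps / 2 * n%:R * m.
    rewrite -(ler_pM2r m0); apply: le_trans ut _.
    apply: (@le_trans _ _ (eps / 2 * n%:R * a * a)); last first.
      rewrite -!mulrA !ler_wpM2l ?invr_ge0 ?ler0n ?(ltW eps0)//.
      by rewrite ler_pM// ltW.
    have -> : eps / 2 * n%:R * a * a = eps / 8 * a.
      have -> : eps / 2 * n%:R * a * a = eps / 2 * (n%:R * a) * a by ring.
      by rewrite na; field.
    rewrite -(ler_pM2r npos) -[leRHS]mulrA (mulrC a) na.
    by move: rhoC1; rewrite -!(mulrA 32); lra.
  have : `|atan (rho / T t)| <= eps / 2 * n%:R * m.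
    by rewrite (le_trans (norm_atan_le _))// ger0_norm.
  by lra.
- move=> t u tab uab; have tpi := in_pi t tab; have upi := in_pi u uab.
  have Tt := T_gt0 t tpi; have Tu := T_gt0 u upi.
  have TL' : `|T t - T u| <= C * `|t - u| by exact: TL.
  have inv (v : R) : a <= v <= pi - a -> (T v)^-1 <= C * (4 * n%:R).
    move=> vab; have vpi := in_pi v vab.
    rewrite -[leLHS]mul1r ler_pdivrMr ?T_gt0//.
    have : a <= C * T v.
      apply: le_trans (min_pi_ge vab) _; apply: TC'.
      by move: vpi => /andP[? ?]; rewrite !ltW.
    rewrite -(ler_pM2l npos) na; lra.
  have -> : e t - e u = (atan (r1 * T t) - atan (r1 * T u)) -
      (atan (rho / T t) - atan (rho / T u)) by rewrite /e; ring.
  have h1 : `|atan (r1 * T t) - atan (r1 * T u)| <= eps / 2 * n%:R * `|t - u|.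
    apply: le_trans (atan_lipschitz _ _) _; rewrite -mulrBr normrM.
    apply: (@le_trans _ _ (`|r1| * (C * `|t - u|))); first by rewrite ler_wpM2l.
    by rewrite mulrCA mulrA ler_wpM2r.
  have h2 : `|atan (rho / T t) - atan (rho / T u)| <= eps / 2 * n%:R * `|t - u|.
    apply: le_trans (atan_lipschitz _ _) _.
    have -> : rho / T t - rho / T u = rho * ((T t)^-1 * (T u)^-1) * (T u - T t).
      by field; rewrite !gt_eqF.
    have [it iu] : 0 <= (T t)^-1 /\ 0 <= (T u)^-1 by rewrite !invr_ge0 !ltW.
    have rtu0 : 0 <= rho * ((T t)^-1 * (T u)^-1) := mulr_ge0 rho0 (mulr_ge0 it iu).
    rewrite normrM (ger0_norm rtu0) (distrC (T u)).
    apply: (@le_trans _ _ (rho * ((C * (4 * n%:R)) * (C * (4 * n%:R))) * (C * `|t - u|))).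
      apply: ler_pM => //; apply: ler_wpM2l => //.
      by apply: ler_pM => //; exact: inv.
    rewrite mulrA ler_wpM2r//.
    have -> : rho * (C * (4 * n%:R) * (C * (4 * n%:R))) * C =
      32 * C ^+ 3 * rho * n%:R * (n%:R / 2) by field.
    have -> : eps / 2 * n%:R = eps * (n%:R / 2) by field.
    by rewrite ler_wpM2r// divr_ge0.
  by rewrite (le_trans (ler_normB _ _))//; lra.
Qed.

(** * Asymptotics *)

(** The lower limit is the supremum of the tail infima, so some tail infimum is positive; it is
    finite because it is at most [|f m|]. *)
Lemma not_approx0_bound (R : realType) (f : nat -> R) :
  not_approx0 f -> exists2 c : R, 0 < c & \forall n \near \oo, c <= `|f n|.
Proof.
pose u n : \bar R := (`|f n|)%:E; rewrite /not_approx0 -/u limn_einf_lim.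
rewrite (cvg_lim _ (@cvg_einfs_sup R u))//.
move=> /ereal_sup_gt[_ [m _ <-]] m0.
have um n : (m <= n)%N -> (einfs u m <= (`|f n|)%:E)%E.
  by move=> mn; apply: ereal_inf_lbound; exists n.
case E : (einfs u m) m0 (um m (leqnn m)) => [c| |] // c0 _.
exists c; first by rewrite lte_fin in c0.
by exists m => // n /= /um; rewrite E lee_fin.
Qed.

Lemma much_less_le (R : realType) (f g : nat -> R) (e : R) : much_less f g -> 0 < e ->
  \forall n \near \oo, g n != 0 /\ `|f n| <= e * `|g n|.
Proof.
move=> [g0 fg] e0; move/cvgrPdist_le: fg => /(_ e e0) fg; near=> n.
have gn0 : g n != 0 by near: n.
split=> //; have : `|0 - f n / g n| <= e by near: n.
by rewrite sub0r normrN normrM normfV ler_pdivrMr ?normr_gt0.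
Unshelve. all: by end_near. Qed.

(** Passing from [n] to [n - 1] in the denominator costs one further [t n], so the relative error is
    at most [(eps n + 1) / (n - 1)]. The bound [beta <= 1 / 2] keeps the target nonzero. *)
Lemma asymp_equal_estimate (R : realType) (k : nat -> nat) (t : nat -> R) (beta : R) :
  (forall n, (1 <= k n)%N) -> beta <= 1 / 2 ->
  (forall eps : R, 0 < eps <= 1 / 2 -> \forall n \near \oo,
     0 < t n /\ `|n%:R * t n - ((k n)%:R - beta) * pi| <= eps * (n%:R * t n)) ->
  asymp_equal t (fun n => ((k n)%:R - beta) / (n%:R - 1) * pi).
Proof.
move=> k1 beta1 tE; split.
- exists 2%N; have : 1 <= (k 2%N)%:R :> R by rewrite ler1n.
  move=> k2; rewrite gt_eqF// mulr_gt0 ?pi_gt0// divr_gt0//; lra.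
- have [|N _ h] := tE (1 / 2); first by apply/andP; split; lra.
  by exists N => // n /h[t0 _]; rewrite gt_eqF.
- apply/cvgrPdist_le => e e0.
  (* For [n >= 4 / e] and [n >= 2], [eps n + 1 <= e n / 2 <= e (n - 1)]. *)
  pose eps := Num.min (e / 4) (1 / 2).
  have eps0 : 0 < eps by rewrite lt_min !divr_gt0.
  have eps2 : eps <= 1 / 2 by rewrite ge_min lexx orbT.
  have eps4 : eps <= e / 4 by rewrite ge_min lexx.
  have epsP : 0 < eps <= 1 / 2 by rewrite eps0.
  near=> n.
  have [tn0 tn] : 0 < t n /\ `|n%:R * t n - ((k n)%:R - beta) * pi| <= eps * (n%:R * t n).
    by near: n; exact: tE.
  have n2 : 2 <= n%:R :> R by rewrite (ler_nat _ 2); near: n; exact: nbhs_infty_ge.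
  have ne : 4 / e <= n%:R.
    by near: n; exact: nbhs_infty_ger.
  have n1 : 0 < n%:R - 1 :> R by lra.
  rewrite sub0r normrN normrM normfV (gtr0_norm tn0) ler_pdivrMr//.
  set A := (k n)%:R - beta in tn *.
  have -> : t n - A / (n%:R - 1) * pi = (n%:R * t n - A * pi - t n) / (n%:R - 1).
    by field; rewrite gt_eqF.
  rewrite normrM normfV (gtr0_norm n1) ler_pdivrMr//.
  have ne4 : 4 <= e * n%:R by move: ne; rewrite ler_pdivrMr// mulrC.
  apply: le_trans (ler_normB _ _) _; rewrite (gtr0_norm tn0).
  have h1 : eps * (n%:R * t n) <= e / 4 * (n%:R * t n).
    by rewrite ler_wpM2r// mulr_ge0// ltW.
  have h2 : t n <= e * n%:R / 4 * t n by rewrite ler_peMl ?(ltW tn0)//; lra.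
  have h3 : e * t n * (n%:R / 2) <= e * t n * (n%:R - 1).
    by rewrite ler_wpM2l ?mulr_ge0 ?(ltW e0) ?(ltW tn0)//; lra.
  by lra.
Unshelve. all: by end_near. Qed.

(** Eventually [k n <= n / 2 <= n - 1], so the index stays within the count of acoustic frequencies
    in both cases. *)
Lemma near_index (R : realType) (k : nat -> nat) :
  much_less (fun n => (k n)%:R : R) (fun n => n%:R) ->
  \forall n \near \oo, (2 <= n)%N /\ (k n <= n.-1)%N.
Proof.
move=> hk; have h : 0 < 1 / 2 :> R by rewrite divr_gt0.
have kn := much_less_le hk h; near=> n.
have n2 : (2 <= n)%N by near: n; exact: nbhs_infty_ge.
split=> //; have [_] : n%:R != 0 :> R /\ `|(k n)%:R : R| <= 1 / 2 * `|n%:R| by near: n.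
rewrite !ger0_norm// mul1r mulrC ler_pdivlMr// -natrM ler_nat => kn2.
have n0 : (0 < n)%N by exact: ltnW.
rewrite -(leq_pmul2r (isT : 0 < 2)%N) (leq_trans kn2)//.
by rewrite -subn1 mulnBl muln2 -addnn -addnBA ?leq_addr.
Unshelve. all: by end_near. Qed.

Theorem lemma5p5 (R : realType) (k1 k2 : R) (k31 k32 : nat -> R) (k : nat -> nat)
    (hk1 : 0 < k1) (hk12 : k1 < k2)
    (hk31 : forall n, 0 <= k31 n) (hk32 : forall n, 0 <= k32 n)
    (hk : forall n, (1 <= k n)%N)
    (hkn : much_less (fun n => (k n)%:R : R) (fun n => n%:R)) :
  (not_approx0 k31 -> much_less (fun n => 1 / n%:R) k32 ->
     asymp_equal
       (fun n => theta k1 k2 (k31 n) (k32 n) n (2 * n - k n + 1)%N)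
       (fun n => (k n)%:R / (n%:R - 1) * pi) /\
     asymp_equal
       (fun n => pi - theta k1 k2 (k31 n) (k32 n) n
                        (2 * n - n2 k1 k2 (k31 n) (k32 n) n + k n)%N)
       (fun n => (k n)%:R / (n%:R - 1) * pi)) /\
  (not_approx0 k31 -> much_less k32 (fun n => 1 / n%:R) ->
     asymp_equal
       (fun n => theta k1 k2 (k31 n) (k32 n) n (2 * n - k n + 1)%N)
       (fun n => ((k n)%:R - 1 / 2) / (n%:R - 1) * pi) /\
     asymp_equal
       (fun n => pi - theta k1 k2 (k31 n) (k32 n) n
                        (2 * n - n2 k1 k2 (k31 n) (k32 n) n + k n)%N)
       (fun n => ((k n)%:R - 1 / 2) / (n%:R - 1) * pi)).
Proof.
have [C C1 [TC TC' TL]] := tan_half_arg_bounds hk1 hk12.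
have k20 : 0 < k2 by lra.
have C0 : 0 < C by lra.
have kn := near_index hkn.
split=> /not_approx0_bound[c c0 k31c] k32n.
- have est eps : 0 < eps <= 1 / 2 -> \forall n \near \oo,
      let t := theta k1 k2 (k31 n) (k32 n) n (2 * n - k n + 1) in
      let u := pi - theta k1 k2 (k31 n) (k32 n) n
                 (2 * n - n2 k1 k2 (k31 n) (k32 n) n + k n) in
      (0 < t /\ `|n%:R * t - ((k n)%:R - 0) * pi| <= eps * (n%:R * t)) /\
      (0 < u /\ `|n%:R * u - ((k n)%:R - 0) * pi| <= eps * (n%:R * u)).
    move=> epsP; have /andP[eps0 _] := epsP.
    (* This constant makes the part [2 k2 / k32] of the right end, times [C], at most [eps n / 2];
       the terms bounded in [n] take the other half. *)
    have d0 : 0 < eps / (4 * C * k2) by rewrite divr_gt0 ?mulr_gt0.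
    have k32d := much_less_le k32n d0.
    near=> n.
    have [n2 knn] : (2 <= n)%N /\ (k n <= n.-1)%N by near: n.
    have n0 : (0 < n)%N by exact: ltnW.
    have npos : 0 < n%:R :> R by rewrite ltr0n.
    have k31n : c <= k31 n by rewrite -[leRHS]ger0_norm//; near: n.
    have [k32n0 k32e'] : k32 n != 0 /\ `|1 / n%:R| <= eps / (4 * C * k2) * `|k32 n|
      by near: n.
    have k31p : 0 < k31 n by lra.
    have k32p : 0 < k32 n by rewrite lt_def k32n0/=.
    have k32e : 1 <= eps / (4 * C * k2) * k32 n * n%:R.
      by move: k32e'; rewrite !ger0_norm ?divr_ge0 ?ler0n// ler_pdivrMr.
    have nC : 2 * C * (k2 / c + 1) <= eps / 2 * n%:R.
      by rewrite [leRHS]mulrC -ler_pdivrMr ?divr_gt0//; near: n; exact: nbhs_infty_ger.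
    apply: (theta_estimate_stiff hk1 hk12 C1 TC TL n0 epsP k31p k32p); last by rewrite hk.
    have r_le (x : R) : 0 < x -> `|(2 * k2 - x) / x| <= 2 * k2 / x + 1.
      move=> x0; rewrite mulrBl divff ?gt_eqF// (le_trans (ler_normB _ _))// normr1.
      by rewrite lerD2r ger0_norm// divr_ge0 ?mulr_ge0 ?ltW.
    have h1 : 2 * k2 / k31 n <= 2 * k2 / c.
      by rewrite ler_pM2l ?mulr_gt0// lef_pV2 ?posrE.
    have h2 : 2 * k2 / k32 n <= eps / (2 * C) * n%:R.
      rewrite ler_pdivrMr//.
      have -> : eps / (2 * C) * n%:R * k32 n =
        2 * k2 * (eps / (4 * C * k2) * k32 n * n%:R) by field; rewrite !gt_eqF.
      by rewrite ler_peMr// mulr_ge0// ltW.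
    have h3 : C * (`|(2 * k2 - k31 n) / k31 n| + `|(2 * k2 - k32 n) / k32 n|) <=
        C * (2 * k2 / c + 1 + (eps / (2 * C) * n%:R + 1)).
      by rewrite ler_pM2l// lerD// (le_trans (r_le _ _))// lerD2r.
    apply: le_trans h3 _.
    have -> : C * (2 * k2 / c + 1 + (eps / (2 * C) * n%:R + 1)) =
      2 * C * (k2 / c + 1) + eps / 2 * n%:R by field; rewrite !gt_eqF.
    by lra.
  split.
    have -> : (fun n => (k n)%:R / (n%:R - 1) * pi) =
      (fun n => ((k n)%:R - 0) / (n%:R - 1) * pi) :> (nat -> R).
      by apply/funext => n; rewrite subr0.
    apply: asymp_equal_estimate => // eps epsP.
    by have := est eps epsP; apply: filterS => n [].
  have -> : (fun n => (k n)%:R / (n%:R - 1) * pi) =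
    (fun n => ((k n)%:R - 0) / (n%:R - 1) * pi) :> (nat -> R).
    by apply/funext => n; rewrite subr0.
  apply: asymp_equal_estimate => // eps epsP.
  by have := est eps epsP; apply: filterS => n [].
- have est eps : 0 < eps <= 1 / 2 -> \forall n \near \oo,
      let t := theta k1 k2 (k31 n) (k32 n) n (2 * n - k n + 1) in
      let u := pi - theta k1 k2 (k31 n) (k32 n) n
                 (2 * n - n2 k1 k2 (k31 n) (k32 n) n + k n) in
      (0 < t /\ `|n%:R * t - ((k n)%:R - 1 / 2) * pi| <= eps * (n%:R * t)) /\
      (0 < u /\ `|n%:R * u - ((k n)%:R - 1 / 2) * pi| <= eps * (n%:R * u)).
    move=> epsP; have /andP[eps0 eps1] := epsP.
    have C30 : 0 < C ^+ 3 by rewrite exprn_gt0.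
    (* Chosen so that [rho <= k32 / k2] gives [32 C^3 rho n <= eps]. *)
    have d0 : 0 < eps * k2 / (32 * C ^+ 3) by rewrite divr_gt0 ?mulr_gt0.
    have k32d := much_less_le k32n d0.
    near=> n.
    have [n2 knn] : (2 <= n)%N /\ (k n <= n.-1)%N by near: n.
    have n0 : (0 < n)%N by exact: ltnW.
    have npos : 0 < n%:R :> R by rewrite ltr0n.
    have n1 : 1 <= n%:R :> R by rewrite ler1n.
    have k31n : c <= k31 n by rewrite -[leRHS]ger0_norm//; near: n.
    have [_ k32e'] : 1 / n%:R != 0 :> R /\
      `|k32 n| <= eps * k2 / (32 * C ^+ 3) * `|1 / n%:R| by near: n.
    have k31p : 0 < k31 n by lra.
    have k32e : k32 n * n%:R <= eps * k2 / (32 * C ^+ 3).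
      by move: k32e'; rewrite !ger0_norm ?divr_ge0 ?ler0n// mul1r ler_pdivlMr.
    have nC : C * (2 * k2 / c + 1) <= eps / 2 * n%:R.
      by rewrite [leRHS]mulrC -ler_pdivrMr ?divr_gt0//; near: n; exact: nbhs_infty_ger.
    have C31 : 1 <= C ^+ 3 by rewrite exprn_ege1.
    (* Keeps [2 k2 - k32 n >= k2], the denominator in [rho]. *)
    have k32k2 : k32 n <= k2.
      have h : k32 n <= k32 n * n%:R by rewrite ler_peMr.
      apply: (le_trans h); apply: (le_trans k32e).
      rewrite ler_pdivrMr ?mulr_gt0// mulrC ler_pM2l//; lra.
    apply: (theta_estimate_soft hk1 hk12 C1 TC TC' TL n0 epsP k31p).
    + by rewrite hk32/=; lra.
    + apply: le_trans nC; rewrite ler_pM2l//.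
      rewrite mulrBl divff ?gt_eqF// (le_trans (ler_normB _ _))// normr1 lerD2r.
      rewrite ger0_norm ?divr_ge0 ?mulr_ge0 ?(ltW k20)//.
      by rewrite ler_pM2l ?mulr_gt0// lef_pV2 ?posrE.
    + have rho_le : k32 n / (2 * k2 - k32 n) <= k32 n / k2.
        by rewrite ler_wpM2l// lef_pV2 ?posrE//; lra.
      apply: (@le_trans _ _ (32 * C ^+ 3 * (k32 n / k2) * n%:R)).
        by rewrite ler_wpM2r// ler_wpM2l ?mulr_ge0// ltW.
      have -> : 32 * C ^+ 3 * (k32 n / k2) * n%:R =
        (k32 n * n%:R) * (32 * C ^+ 3) / k2 by field; rewrite gt_eqF.
      rewrite ler_pdivrMr//.
      by move: k32e; rewrite ler_pdivlMr// mulr_gt0.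
    + by rewrite hk (leq_trans knn)// leq_pred.
  split; apply: asymp_equal_estimate => // eps epsP;
    by have := est eps epsP; apply: filterS => n [].
Unshelve. all: by end_near. Qed.
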